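(* Let $\eta\in(0,1/2)$. For all integers $d\ge8$, $N\ge1$ and every $\mathbf a\in\mathcal W(d,N)$, $$\frac{1}{\#\mathcal T_{\mathbf a,\mathcal V^2}}\#\Bigl\{(\mathbf v_1,\mathbf v_2)\in\mathcal T_{\mathbf a,\mathcal V^2}:\bigl|\operatorname{dist}_d(\mathbf a,\mathbf v_1)-\operatorname{dist}_d(\mathbf a,\mathbf v_2)\bigr|\le\tfrac{2}{d^\eta}\Bigr\}\ge1-\frac{2}{d^{1-2\eta}}.$$
   Context: $\mathcal W(d,N)=\{0,1,\dots,N\}^d$, $\mathcal V=\{0,N\}^d$ (vertices of $[0,N]^d$). $\operatorname{dist}_d(\mathbf u,\mathbf v)=\frac{1}{\sqrt d\,N}\bigl(\sum_j(u_j-v_j)^2\bigr)^{1/2}$. $\mathcal T_{\mathbf a,\mathcal V^2}\subset\mathcal V^2$ is the set of pairs $(\mathbf v_1,\mathbf v_2)$ of vertices which together with $\mathbf a$ form a non-degenerate triangle, i.e. $\mathbf a,\mathbf v_1,\mathbf v_2$ are distinct. *)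

(* Defs.v *)
From HB Require Import structures.
From mathcomp Require Import all_boot all_order all_algebra.
From mathcomp Require Import reals.

Set Implicit Arguments.
Unset Strict Implicit.
Unset Printing Implicit Defensive.

Import Order.TTheory GRing.Theory Num.Theory.
Local Open Scope ring_scope.

Definition lattice (d N : nat) := {ffun 'I_d -> 'I_N.+1}.

Definition vertices (d N : nat) : {set lattice d N} :=
  [set v : {ffun 'I_d -> 'I_N.+1} | [forall j, (v j == 0%N :> nat) || (v j == N :> nat)]].

Definition dist (R : realType) (d N : nat) (u v : lattice d N) : R :=
  1 / (Num.sqrt (d%:R) * N%:R) *
  Num.sqrt (\sum_(j < d) ((u j)%:R - (v j)%:R) ^+ 2).

(* Ordered pairs; "non-degenerate" only means that the three points are
   pairwise distinct, so collinear triples are not excluded. *)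
Definition triangles (d N : nat) (a : lattice d N) :
    {set lattice d N * lattice d N} :=
  [set p : lattice d N * lattice d N |
    [&& p.1 \in vertices d N, p.2 \in vertices d N,
               a != p.1, a != p.2 & p.1 != p.2]].

(* Main.v *)
Require Import Defs.
From HB Require Import structures.
From mathcomp Require Import all_boot all_order all_algebra.
From mathcomp Require Import reals exp.
From mathcomp Require Import ring lra zify.

Import Order.TTheory GRing.Theory Num.Theory.
Local Open Scope ring_scope.

(** A second-moment argument.  For a uniformly random vertex [v], the squared
    distance [S] from [a] is a sum of independent two-valued variables, with
    mean [A = (d N^2 + s) / 4] and variance [N^2 s / 4], where
    [s] is the sum of the [(N - 2 a_j)^2], so that [s <= d N^2].  Since
    [(sqrt S - sqrt A)^2 * A <= (S - A)^2], the distance deviates from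
    [sqrt A] by at most [N^2 / 2] in mean square.  Markov's inequality for the
    square of the difference of two distances then bounds the proportion of bad
    pairs among all pairs of vertices by a quarter of the claimed bound, which
    leaves room for discarding the degenerate triangles. *)

Lemma card_vertices (d N : nat) : (0 < N)%N -> #|vertices d N| = (2 ^ d)%N.
Proof.
move=> N0.
have <- : #|[set (ord0 : 'I_N.+1); ord_max]| = 2%N.
  by rewrite cards2 -val_eqE /= eq_sym -lt0n N0.
rewrite -[d in RHS]card_ord -(card_ffun_on 'I_d) cardsE; apply: eq_card => v.
rewrite unfold_in /=; apply/forallP/ffun_onP => h j; have := h j.
  by rewrite !inE -!val_eqE.
by rewrite !inE -!val_eqE.
Qed.

(** A degenerate pair of vertices has first entry [a], second entry [a], or two equal entries; each
    case accounts for at most [#|vertices d N|] pairs. *)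
Lemma card_triangles_ge (d N : nat) (a : lattice d N) :
  (#|vertices d N| * #|vertices d N|
     <= #|triangles a| + 3 * #|vertices d N|)%N.
Proof.
set V := vertices d N.
pose D := [set (v, v) | v in V].
have sub : setX V V \subset
    triangles a :|: (setX [set a] V :|: (setX V [set a] :|: D)).
  apply/subsetP => -[u v]; rewrite in_setX /= => /andP[uV vV].
  rewrite !in_setU !in_setX !in_set1 [_ \in triangles a]inE /= -/V uV vV /=.
  rewrite andbT ![a == _]eq_sym.
  case: (u =P a) => [->|_]; rewrite /= ?orbT //.
  case: (v =P a) => [->|_]; rewrite /= ?orbT //.
  case: (u =P v) => [<-|_] //=.
  by apply/imsetP; exists u.
have := subset_leq_card sub; rewrite cardsX => h.
apply: (leq_trans h); apply: (leq_trans (leq_card_setU _ _).1).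
rewrite leq_add2l; apply: (leq_trans (leq_card_setU _ _).1).
have -> : (3 * #|V| = #|V| + (#|V| + #|V|))%N by lia.
apply: leq_add; first by rewrite cardsX cards1 mul1n.
apply: (leq_trans (leq_card_setU _ _).1).
by apply: leq_add; [rewrite cardsX cards1 muln1 | exact: leq_imset_card].
Qed.

(** Reflection of the cube in direction [i], sending the coordinate [k] to [N - k]. Its symmetry
    stands in for independence of the coordinates of a random vertex. *)
Definition flip_coord (d N : nat) (i : 'I_d) (v : lattice d N) : lattice d N :=
  [ffun j => if j == i then rev_ord (v j) else v j].

Lemma flip_coordK (d N : nat) (i : 'I_d) : involutive (@flip_coord d N i).
Proof.
move=> v; apply/ffunP => j; rewrite !ffunE.
by case: eqP => // _; rewrite rev_ordK.
Qed.

Lemma flip_coord_vertices (d N : nat) (i : 'I_d) (v : lattice d N) :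
  (flip_coord d N i v \in vertices d N) = (v \in vertices d N).
Proof.
suff imp w : w \in vertices d N -> flip_coord d N i w \in vertices d N.
  by apply/idP/idP => [/imp|/imp //]; rewrite flip_coordK.
rewrite !inE => /forallP h; apply/forallP => j; rewrite ffunE.
case: ifP => _ //; have := h j; rewrite /= subSS.
by case/orP => /eqP ->; rewrite ?subn0 ?subnn ?eqxx ?orbT.
Qed.

(** On vertices this turns the square of a coordinate into [N] times that coordinate, so quadratic
    expressions become affine. *)
Lemma vertex_coord (R : realType) (d N : nat) (v : lattice d N) (j : 'I_d) :
  v \in vertices d N -> (v j)%:R * ((v j)%:R - N%:R) = 0 :> R.
Proof.
rewrite inE => /forallP /(_ j) /orP[] /eqP ->; first by rewrite mul0r.
by rewrite subrr mulr0.
Qed.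

(** Factor [p - q] as the difference times the sum of the square roots; the sum is at least
    [Num.sqrt q]. *)
Lemma sqr_sqrt_sub_le (R : realType) (p q : R) : 0 <= p -> 0 <= q ->
  (Num.sqrt p - Num.sqrt q) ^+ 2 * q <= (p - q) ^+ 2.
Proof.
move=> p0 q0; rewrite -{2}(sqr_sqrtr q0) -{2}(sqr_sqrtr p0) -{3}(sqr_sqrtr q0).
rewrite subr_sqr [X in _ <= X]exprMn ler_wpM2l ?sqr_ge0 //.
by rewrite ler_sqr ?nnegrE ?addr_ge0 ?sqrtr_ge0 // lerDr sqrtr_ge0.
Qed.

Section Moments.
Variables (R : realType) (d N : nat) (a : lattice d N).
Hypothesis N_gt0 : (0 < N)%N.

Let V := vertices d N.
Let n : R := N%:R.
Let x (j : 'I_d) : R := (a j)%:R.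
Let w (v : lattice d N) (j : 'I_d) : R := (v j)%:R - n / 2.
Let S (v : lattice d N) : R := \sum_(j < d) ((a j)%:R - (v j)%:R) ^+ 2.
Let s : R := \sum_(j < d) (n - 2 * x j) ^+ 2.
Let A : R := (d%:R * n ^+ 2 + s) / 4.

(** On a vertex [w v i] is [n / 2] up to sign, which gives the diagonal. Off it, flipping coordinate
    [i] negates [w v i] and fixes [w v j], so the sum equals its own negative. *)
Lemma sum_centered_mul (i j : 'I_d) :
  \sum_(v in V) w v i * w v j = if i == j then #|V|%:R * (n ^+ 2 / 4) else 0.
Proof.
case: eqP => [<-|/eqP ij].
  rewrite (eq_bigr (fun _ => n ^+ 2 / 4)); last first.
    by move=> v /(vertex_coord R d N v i); rewrite /w -/n => h; lra.
  by rewrite sumr_const mulr_natl.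
set T := LHS; suff : T = - T by move=> h; lra.
rewrite {1}/T (reindex_inj (inv_inj (flip_coordK d N i))) /=.
under eq_bigl do rewrite flip_coord_vertices.
rewrite /T -sumrN; apply: eq_bigr => v _.
rewrite /w !ffunE eqxx eq_sym (negbTE ij) /= subSS natrB; last first.
  by rewrite -ltnS.
by rewrite -/n; field.
Qed.

Lemma variance_sum (b : 'I_d -> R) :
  \sum_(v in V) (\sum_j b j * w v j) ^+ 2 =
  #|V|%:R * (n ^+ 2 / 4) * \sum_j b j ^+ 2.
Proof.
under eq_bigr => v _ do rewrite expr2 big_distrlr /=.
rewrite exchange_big mulr_sumr /=; apply: eq_bigr => i _.
rewrite exchange_big (bigD1 i) //= [X in _ + X]big1 ?addr0 => [|j ji].
  under eq_bigr do rewrite mulrACA.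
  by rewrite -mulr_sumr sum_centered_mul eqxx; ring.
under eq_bigr do rewrite mulrACA.
by rewrite -mulr_sumr sum_centered_mul eq_sym (negbTE ji) mulr0.
Qed.

Lemma sqdist_centered (v : lattice d N) : v \in V ->
  S v - A = \sum_j (n - 2 * x j) * w v j.
Proof.
move=> vV; rewrite /S /A /s.
have -> : d%:R * n ^+ 2 = \sum_(j < d) n ^+ 2.
  by rewrite sumr_const card_ord mulr_natl.
rewrite -big_split /= mulr_suml -sumrB; apply: eq_bigr => j _.
by have := vertex_coord R d N v j vV; rewrite /w /x -/n => h; lra.
Qed.

Lemma sum_sqr_offset_le : s <= d%:R * n ^+ 2.
Proof.
have -> : d%:R * n ^+ 2 = \sum_(j < d) n ^+ 2.
  by rewrite sumr_const card_ord mulr_natl.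
apply: ler_sum => j _.
have x0 : 0 <= x j by rewrite ler0n.
have xn : x j <= n by rewrite ler_nat -ltnS.
by nra.
Qed.

Lemma dist_concentration : (0 < d)%N ->
  \sum_(v in V) (Num.sqrt (S v) - Num.sqrt A) ^+ 2 <= #|V|%:R * (n ^+ 2 / 2).
Proof.
move=> d0.
have n0 : 0 < n by rewrite ltr0n.
have dn0 : 0 < d%:R * n ^+ 2 by rewrite mulr_gt0 ?exprn_gt0 // ltr0n.
have s0 : 0 <= s by apply: sumr_ge0 => j _; exact: sqr_ge0.
have A0 : 0 < A by rewrite /A divr_gt0 // ltr_wpDr.
rewrite -(ler_pM2r A0) mulr_suml.
apply: (@le_trans _ _ (\sum_(v in V) (S v - A) ^+ 2)).
  apply: ler_sum => v _; apply: sqr_sqrt_sub_le (ltW A0).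
  by apply: sumr_ge0 => j _; exact: sqr_ge0.
under eq_bigr => v vV do rewrite (sqdist_centered v vV).
rewrite variance_sum -/s -[leLHS]mulrA -[leRHS]mulrA ler_wpM2l ?ler0n //.
rewrite -[leLHS]mulrA -[leRHS]mulrA ler_wpM2l ?sqr_ge0 //.
(* What remains is [s <= 2 * A], that is, [s <= d * n ^ 2]. *)
by have := sum_sqr_offset_le; rewrite /A => h; lra.
Qed.

Lemma sum_sqr_dist_sub : (0 < d)%N ->
  \sum_(p in setX V V) (dist R a p.1 - dist R a p.2) ^+ 2
    <= 2 * #|V|%:R ^+ 2 / d%:R.
Proof.
move=> d0.
have n0 : 0 < n by rewrite ltr0n.
have dR0 : 0 < d%:R :> R by rewrite ltr0n.
have dn0 : 0 < d%:R * n ^+ 2 by rewrite mulr_gt0 ?exprn_gt0.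
pose g v := (Num.sqrt (S v) - Num.sqrt A) ^+ 2.
have ptw (u v : lattice d N) : (dist R a u - dist R a v) ^+ 2
    <= 2 / (d%:R * n ^+ 2) * (g u + g v).
  rewrite /dist -mulrBr exprMn div1r exprVn exprMn sqr_sqrtr ?ler0n // -/n.
  rewrite [2 / _]mulrC -mulrA ler_wpM2l ?invr_ge0 ?(ltW dn0) // /g -/(S u).
  rewrite -/(S v); set p := Num.sqrt (S u); set q := Num.sqrt (S v).
  (* Parallelogram law: with [c] the root of [A], this square plus [(p - q) ^ 2] equals
     [2 * (p - c) ^ 2 + 2 * (q - c) ^ 2]. *)
  by have := sqr_ge0 (p + q - 2 * Num.sqrt A); lra.
apply: (@le_trans _ _
  (\sum_(u in V) \sum_(v in V) 2 / (d%:R * n ^+ 2) * (g u + g v))).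
  rewrite pair_big /= (eq_bigl (fun p => (p.1 \in V) && (p.2 \in V))).
    by apply: ler_sum => p _; exact: ptw.
  by case=> u v; rewrite in_setX.
under eq_bigr => u _ do rewrite -mulr_sumr big_split /= sumr_const.
rewrite -mulr_sumr big_split /= sumr_const sumrMnl.
rewrite -[(\sum_(u in V) g u) *+ _]mulr_natl.
have -> : 2 * #|V|%:R ^+ 2 / d%:R = 2 / (d%:R * n ^+ 2) *
   (#|V|%:R * (#|V|%:R * (n ^+ 2 / 2)) + #|V|%:R * (#|V|%:R * (n ^+ 2 / 2))) :> R.
  by field; rewrite ?gt_eqF.
rewrite ler_wpM2l ?divr_ge0 ?(ltW dn0) // lerD //;
  by rewrite ler_wpM2l ?ler0n //; exact: dist_concentration.
Qed.

End Moments.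

Lemma markov_count (R : realType) (T : finType) (B C : {set T}) (f : T -> R)
    (c : R) : B \subset C -> (forall p, 0 <= f p) ->
  (forall p, p \in B -> c <= f p) -> #|B|%:R * c <= \sum_(p in C) f p.
Proof.
move=> BC f0 hB; rewrite mulr_natl -sumr_const.
apply: (le_trans (ler_sum _ hB)).
rewrite [leRHS](big_setID B) /= (setIidPr BC) lerDl.
by apply: sumr_ge0.
Qed.

Theorem theorem4p1 (R : realType) (eta : R) (heta0 : 0 < eta)
    (heta1 : eta < 1 / 2) (d N : nat) (hd : (8 <= d)%N) (hN : (1 <= N)%N)
    (a : lattice d N) :
  1 - 2 / (d%:R `^ (1 - 2 * eta)) <=
  1 / (#|triangles a|)%:R *
  (#|[set p in triangles a |
      `| dist R a p.1 - dist R a p.2 | <= 2 / (d%:R `^ eta)]|)%:R :> R.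
Proof.
set G := [set p in _ | _].
pose B := triangles a :\: G.
have d0 : (0 < d)%N by lia.
have dR0 : 0 < d%:R :> R by rewrite ltr0n.
set t := d%:R `^ eta.
have t0 : 0 < t by exact: powR_gt0.
(* The allowed loss becomes [2 * t ^ 2 / d], leaving only algebra in [t]. *)
have -> : d%:R `^ (1 - 2 * eta) = d%:R / t ^+ 2 :> R.
  rewrite powRB; last by rewrite (gt_eqF dR0) implybT.
  by rewrite powRr1 ?ler0n // [2 * _]mulrC powRrM powR_mulrn // ltW.
have GT : G \subset triangles a.
  by apply/subsetP => p; rewrite inE => /andP[].
have cardB : #|triangles a|%:R = #|G|%:R + #|B|%:R :> R.
  by rewrite -natrD -(cardsID G (triangles a)) (setIidPr GT).
have BV : B \subset setX (vertices d N) (vertices d N).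
  apply/subsetP => -[u v]; rewrite in_setD in_setX [_ \in triangles a]inE.
  by case/andP=> _ /and5P[-> ->].
have badB p : p \in B ->
    (2 / t) ^+ 2 <= (dist R a p.1 - dist R a p.2) ^+ 2.
  rewrite in_setD [p \in G]inE => /andP[+ pT]; rewrite pT /= -ltNge => h.
  by rewrite -[leRHS]real_normK ?num_real // ler_sqr ?nnegrE ?divr_ge0 ?(ltW t0) ?(ltW h).
have := le_trans (markov_count R _ _ _ _ _ BV
  (fun p => sqr_ge0 (dist R a p.1 - dist R a p.2)) badB)
  (sum_sqr_dist_sub R d N a hN d0).
have := card_triangles_ge d N a.
have : (4 <= #|vertices d N|)%N.
  by rewrite card_vertices // (@leq_pexp2l 2 2) //; lia.
set V := #|vertices d N|; set M := #|triangles a| in cardB *.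
(* Since [V >= 4], the at most [3 * V] degenerate pairs make up at most three quarters of all
   [V * V] pairs. *)
move=> V4 VM; have {VM V4}[M0 VM] : (0 < M)%N /\ (V * V <= 4 * M)%N by nia.
have MR0 : 0 < M%:R :> R by rewrite ltr0n.
have {}VM : V%:R ^+ 2 <= 4 * M%:R :> R.
  by rewrite expr2 -!natrM ler_nat.
(* Markov gives [#|B| * (2 / t) ^ 2 <= 2 * V ^ 2 / d], and the right side is at most [8 * M / d]. *)
move=> hB; have {}hB : #|B|%:R <= 2 * M%:R * t ^+ 2 / d%:R :> R.
  have c0 : 0 < (2 / t) ^+ 2 by rewrite exprn_gt0 // divr_gt0.
  rewrite -(ler_pM2r c0); apply: (le_trans hB).
  have -> : 2 * M%:R * t ^+ 2 / d%:R * (2 / t) ^+ 2 = 2 * (4 * M%:R) / d%:R :> R.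
    by field; rewrite ?gt_eqF.
  by rewrite ler_wpM2r ?invr_ge0 ?ler0n // ler_wpM2l.
rewrite [leRHS]mulrC div1r ler_pdivlMr // mulrBl mul1r.
have -> : 2 / (d%:R / t ^+ 2) * M%:R = 2 * M%:R * t ^+ 2 / d%:R :> R.
  by field; rewrite ?gt_eqF.
by lra.
Qed.
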